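(* Let $p\ge 19$ be prime, $0<\alpha\le1/2$, and $\alpha^{3+e^{-133}}\le\beta\le\alpha^3\min(p^{-\log p},p^{-50})$. Then $$n_p(\alpha,\beta)\ge \mathrm{Tow}\!\left(p,\tfrac{1}{30}(\log p)\ln\!\Big(\tfrac{\log(1/\alpha)}{\log(\alpha^3/\beta)}\Big),\alpha^3/\beta\right);$$ that is, there is $n$ at least this large and a set $A\subseteq\mathbb{F}_p^n$ of density at least $\alpha$ such that for every nonzero $d\in\mathbb{F}_p^n$ the density of 3-APs in $A$ with common difference $d$ is less than $\beta$.
   Context: For a prime $p$, $A\subseteq\mathbb{F}_p^n$ has density $|A|/p^n$; the density of 3-APs in $A$ with common difference $d$ is $p^{-n}|\{x: x,x+d,x+2d\in A\}|$. $n_p(\alpha,\beta)$ is the least positive integer $N$ such that for all $n\ge N$ and all $A\subseteq\mathbb{F}_p^n$ of density at least $\alpha$ some nonzero $d$ has 3-AP density at least $\beta$. $\mathrm{Tow}(a,0,r)=r$, $\mathrm{Tow}(a,k+1,r)=a^{\mathrm{Tow}(a,k,r)}$, non-integer heights rounded down. $\log$ is base 2, $\ln$ natural. *)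

(* Defs.v *)
From HB Require Import structures.
From mathcomp Require Import all_boot all_order all_algebra.
From Stdlib Require Import Reals.

Set Implicit Arguments.
Unset Strict Implicit.
Unset Printing Implicit Defensive.

Definition log2 (x : R) : R := (ln x / ln 2)%R.

Fixpoint Tow (a : R) (k : nat) (r : R) : R :=
  match k with
  | O => r
  | S k' => Rpower a (Tow a k' r)
  end.

(* Tower with real height, rounded down (heights used here are positive). *)
Definition TowR (a h r : R) : R := Tow a (Z.to_nat (Int_part h)) r.

Definition density (p n : nat) (A : {set 'rV['F_p]_n}) : R :=
  (INR #|A| / (INR p ^ n))%R.

Definition ap3_density (p n : nat) (A : {set 'rV['F_p]_n}) (d : 'rV['F_p]_n) : R :=
  (INR #|[set x : 'rV['F_p]_n | [&& x \in A, (GRing.add x d) \in A & (GRing.add x (GRing.add d d)) \in A]]|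
     / (INR p ^ n))%R.

(* Main.v *)
Require Import Defs.
From HB Require Import structures.
From mathcomp Require Import all_boot all_order all_algebra.
From mathcomp Require Import zify ring.

(**
Write K = alpha^3/beta and B = 1/(2K). One builds sets A in F_p^n, of density a,
all of whose nonzero differences have 3-AP density at most B a^3, by iterating a
lifting step. Behrend's construction with digits 0, .., (p-1)/2 gives a 3-AP-free
S in F_p^k of density about 2^(-k). To each x in F_p^n attach a random linear map
V_x : F_p^m -> F_p^k and put A' = {(x, y) : x in A, y V_x in S}. If V_x, V_(x+d) and
V_(x+2d) are jointly surjective for all x and all d <> 0, then a difference with
nonzero first coordinate d contributes exactly the 3-AP density of d in A times the
cube of the density of S; a difference (0, d) only sees those x in A with d V_x = 0,
because S is 3-AP-free. Since a first-moment bound on an exponential of their number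
leaves few such x for every d as soon as p^k exceeds a power of 1/a, and allows m to
be exponential in n, one step exponentiates the dimension while ln (1/a) is only
multiplied by 1 + O(1/ln p). About ln p * ln (ln (1/alpha) / ln K) steps are therefore
available. The first step lifts one Behrend set by another, and this is where p >= 19
is needed: 10^178 > 19^139 and 10^228 > 19^178. In the last step the size of S is
chosen to land on density alpha.
*)

Set Implicit Arguments.
Unset Strict Implicit.
Unset Printing Implicit Defensive.
Import GRing.Theory.

(** * Counting random assignments of linear maps *)

Section Counting.
Local Open Scope ring_scope.

(** The maps [t] inject each fibre of [f] into every other, so all fibres have the same size. In
    every application [t] is a translation. *)
Lemma card_preimset_uniform (U V : finType) (f : U -> V) (S : {set V}) :
  (forall v v', exists2 t : U -> U, injective t & forall u, f u = v -> f (t u) = v') ->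
  (#|f @^-1: S| * #|V| = #|S| * #|U|)%N.
Proof.
move=> ft; pose c v := #|f @^-1: [set v]|.
have le_c v v' : (c v <= c v')%N.
  have [t t_inj tP] := ft v v'.
  rewrite /c -(card_imset _ t_inj); apply/subset_leq_card/subsetP => w /imsetP[u].
  by rewrite !inE => /eqP fu ->; apply/eqP/tP.
have cardS (S' : {set V}) : #|f @^-1: S'| = (\sum_(v in S') c v)%N.
  rewrite -sum1_card (partition_big f (mem S')) => [|u]; last by rewrite inE.
  apply: eq_bigr => v vS; rewrite /c -sum1_card; apply: eq_bigl => u.
  by rewrite !inE; case: eqP => [->|]; rewrite ?andbT ?andbF ?vS.
have [v0 _|V0] := pickP (mem [set: V]); last first.
  have card0 : #|V| = 0%N by apply: eq_card0 => v; have := V0 v; rewrite !inE.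
  by rewrite card0 muln0; move: (max_card (mem S)); rewrite card0 leqn0 => /eqP ->.
have cE v : c v = c v0 by apply/eqP; rewrite eqn_leq !le_c.
have -> : #|U| = #|f @^-1: [set: V]| by rewrite preimsetT cardsT.
have cS (S' : {set V}) : #|f @^-1: S'| = (#|S'| * c v0)%N.
  by rewrite cardS -sum_nat_const; apply: eq_bigr => v _; apply: cE.
by rewrite !cS cardsT mulnAC mulnA.
Qed.

Lemma leq_card_bigcup (I T : finType) (P : pred I) (F : I -> {set T}) :
  (#|\bigcup_(i | P i) F i| <= \sum_(i | P i) #|F i|)%N.
Proof.
apply: (big_ind2 (fun (X : {set T}) y => #|X| <= y)%N) => [|X x Y y Xx Yy|//].
  by rewrite cards0.
by apply: leq_trans (leq_card_setU X Y) _; apply: leq_add.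
Qed.

Variable p : nat.
Hypothesis p_pr : prime p.
Local Notation F := 'F_p.

Lemma card_FpM (m n : nat) : #|{: 'M[F]_(m, n)}| = (p ^ (m * n))%N.
Proof. by rewrite card_mx card_Fp. Qed.

Lemma card_preim_mulmx (m l : nat) (X : 'M[F]_(m, l)) (S : {set 'rV[F]_l}) :
  row_full X -> (#|[set y : 'rV[F]_m | y *m X \in S]| * p ^ l = #|S| * p ^ m)%N.
Proof.
case/row_fullP=> Y YX.
have := @card_preimset_uniform _ _ (fun y : 'rV[F]_m => y *m X) S.
rewrite !card_FpM !mul1n => <- // v v'.
exists (fun u => u + (v' - v) *m Y) => [u1 u2 /addIr //|u uX].
by rewrite mulmxDl uX -mulmxA YX mulmx1 addrC subrK.
Qed.

Lemma row_nz_rinv (m : nat) (d : 'rV[F]_m) : d != 0 -> exists e : 'cV[F]_m, d *m e = 1%:M.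
Proof. by move=> d0; apply/row_freeP; rewrite /row_free rank_rV d0. Qed.

Lemma card_mulmx_eq0 (m k : nat) (d : 'rV[F]_m) :
  d != 0 -> (#|[set M : 'M[F]_(m, k) | d *m M == 0%R]| * p ^ k = p ^ (m * k))%N.
Proof.
case/row_nz_rinv=> e de.
have := @card_preimset_uniform _ _ (fun M : 'M[F]_(m, k) => d *m M) [set 0].
rewrite !card_FpM cards1 !mul1n => <-; last first.
  move=> v v'; exists (fun M => M + e *m (v' - v)) => [u1 u2 /addIr //|u du].
  by rewrite mulmxDr du mulmxA de mul1mx addrC subrK.
by congr (_ * _)%N; apply: eq_card => M; rewrite !inE.
Qed.

Variables (n m k : nat).
Local Notation X := 'rV[F]_n.
Local Notation Assign := {ffun X -> 'M[F]_(m, k)}.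

(** Adding [(w' - w) *m r] to the single value [v x], where [r *m c x = 1], moves the sum from [w]
    to [w']; hence the sum is uniform on columns of height [m]. *)
Lemma card_assign_relation (c : X -> 'cV[F]_k) x : c x != 0 ->
  (#|[set v : Assign | (\sum_y v y *m c y == 0)%R]| * p ^ m = #|Assign|)%N.
Proof.
move=> cx0; have [r rc] : exists r : 'rV[F]_k, r *m c x = 1%:M.
  have [|e ee] := @row_nz_rinv k (c x)^T.
    by apply: contra cx0 => /eqP c0; rewrite -[c x]trmxK c0 trmx0.
  by exists e^T; rewrite -[c x]trmxK -trmx_mul ee trmx1.
have := @card_preimset_uniform _ _ (fun v : Assign => \sum_y v y *m c y) [set 0].
rewrite !card_FpM cards1 muln1 mul1n => <-; last first.
  move=> w w'; exists (fun v : Assign => [ffun y => v y + (if y == x then (w' - w) *m r else 0)]).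
    by move=> v1 v2 /ffunP E; apply/ffunP=> y; move: (E y); rewrite !ffunE => /addIr.
  move=> v vw; under eq_bigr do rewrite ffunE mulmxDl.
  rewrite big_split /= vw (bigD1 x) //= eqxx big1 => [|y /negPf ->]; last by rewrite mul0mx.
  by rewrite -mulmxA rc mulmx1 addr0 addrC subrK.
by congr (_ * _)%N; apply: eq_card => M; rewrite !inE.
Qed.

Definition zeros (A : {set X}) (v : Assign) (d : 'rV[F]_m) := [set x in A | d *m v x == 0].

(** The values [v x] are independent, so the exponential moment of the number of zeros factors over
    the points of [A]; each factor has mean [1 + W / p ^ k]. *)
Lemma sum_expn_zeros (A : {set X}) (d : 'rV[F]_m) (W : nat) : d != 0 ->
  ((\sum_(v : Assign) W.+1 ^ #|zeros A v d|) * p ^ (k * #|A|)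
    = #|Assign| * (p ^ k + W) ^ #|A|)%N.
Proof.
move=> d0; pose G (x : X) (M : 'M[F]_(m, k)) := (if (x \in A) && (d *m M == 0%R) then W.+1 else 1)%N.
have sumG x : ((\sum_M G x M) * (if x \in A then p ^ k else 1)
    = #|{: 'M[F]_(m, k)}| * (if x \in A then p ^ k + W else 1))%N.
  rewrite /G; case: (x \in A) => /=; last by rewrite sum1_card !muln1.
  have z := card_mulmx_eq0 k d0.
  set Z := [set M | _] in z.
  have -> : (\sum_(M : 'M[F]_(m, k)) (if (d *m M == 0)%R then W.+1 else 1) = #|{: 'M[F]_(m, k)}| + W * #|Z|)%N.
    rewrite (eq_bigr (fun M => 1 + if (M : 'M[F]_(m, k)) \in Z then W else 0)%N) => [|M _]; last by rewrite inE; case: ifP.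
    rewrite big_split /= -big_mkcond !sum_nat_const muln1 [(#|Z| * _)%N]mulnC.
    by congr (_ + _)%N; apply: eq_card.
  by rewrite mulnDl -mulnA z card_FpM mulnDr [(W * _)%N]mulnC.
have -> : (\sum_(v : Assign) W.+1 ^ #|zeros A v d| = \prod_x \sum_M G x M)%N.
  rewrite bigA_distr_bigA /=; apply: eq_bigr => v _.
  rewrite /G -big_mkcond /= prod_nat_const; congr (_ ^ _)%N.
  by apply: eq_card => x; rewrite !inE.
have powA a : (a ^ #|A| = \prod_(x : X) if x \in A then a else 1)%N.
  by rewrite -big_mkcond prod_nat_const.
rewrite expnM !powA card_ffun -prod_nat_const -!big_split /=.
by apply: eq_bigr => x _; rewrite sumG.
Qed.

Definition triple_mx (v : X -> 'M[F]_(m, k)) x d :=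
  row_mx (v x) (row_mx (v (x + d)) (v (x + (d + d)))).

Lemma ap_distinct (x d : X) : (2 < p)%N -> d != 0 ->
  [/\ (x + d == x) = false, (x + (d + d) == x) = false & (x + (d + d) == x + d) = false].
Proof.
move=> p2 d0; suff dd : d + d != 0.
  split; apply/negbTE.
  - by rewrite -{2}[x]addr0 (inj_eq (addrI x)).
  - by rewrite -{2}[x]addr0 (inj_eq (addrI x)).
  - by rewrite (inj_eq (addrI x)) -{3}[d]addr0 (inj_eq (addrI d)).
have -> : d + d = 2%:R *: d by rewrite scaler_nat mulr2n.
rewrite scaler_eq0 (negPf d0) orbF.
by rewrite -(dvdn_pcharf (pchar_Fp p_pr)) gtnNdvd.
Qed.

(** Failure of full column rank means that some nonzero column [c] of height [3 * k] is annihilated.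
    As the three points are distinct, this is a nontrivial relation between independent values of
    [v], of probability [1 / p ^ m]; then sum over [c]. *)
Lemma card_triple_dependent (x d : X) : (2 < p)%N -> d != 0 ->
  (#|[set v : Assign | ~~ row_full (triple_mx v x d)]| * p ^ m <= p ^ (3 * k) * #|Assign|)%N.
Proof.
move=> p2 d0; have [E1 E2 E3] := ap_distinct x p2 d0.
pose rel (c : 'cV[F]_(k + (k + k))) (y : X) : 'cV[F]_k :=
  if y == x then usubmx c else if y == x + d then usubmx (dsubmx c)
  else if y == x + (d + d) then dsubmx (dsubmx c) else 0.
pose R c := [set v : Assign | \sum_y v y *m rel c y == 0].
have sub : [set v : Assign | ~~ row_full (triple_mx v x d)] \subset \bigcup_(c | c != 0) R c.
  apply/subsetP=> v; rewrite inE -col_leq_rank -ltnNge => lt_rk.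
  have : (triple_mx v x d)^T \in [pred M | ~~ row_free M].
    by rewrite inE /row_free mxrank_tr neq_ltn lt_rk.
  rewrite inE -kermx_eq0 => /rowV0Pn[u /sub_kermxP u0 un0].
  apply/bigcupP; exists u^T; first by apply: contra un0 => /eqP E; rewrite -[u]trmxK E trmx0.
  rewrite inE; have : triple_mx v x d *m u^T == 0 by rewrite -[triple_mx v x d]trmxK -trmx_mul u0 trmx0.
  rewrite (bigD1 x) //= (bigD1 (x + d)) ?E1 //= (bigD1 (x + (d + d))) ?E2 ?E3 //= big1; last first.
    by move=> y /andP[/andP[yx yd] ydd]; rewrite /rel (negPf yx) (negPf yd) (negPf ydd) mulmx0.
  rewrite /rel eqxx E1 eqxx E2 E3 eqxx addr0 -{1}[u^T]vsubmxK -{1}[dsubmx u^T]vsubmxK.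
  by rewrite /triple_mx !mul_row_col.
have cardR c : c != 0 -> (#|R c| * p ^ m = #|Assign|)%N.
  move=> c0; have [rx|rx] := boolP (rel c x == 0); last exact: card_assign_relation rx.
  have [rd|rd] := boolP (rel c (x + d) == 0); last exact: card_assign_relation rd.
  apply: (@card_assign_relation _ (x + (d + d))); apply: contra c0.
  move: rx rd; rewrite /rel eqxx E1 eqxx E2 E3 eqxx => /eqP r1 /eqP r2 /eqP r3.
  by rewrite -[c]vsubmxK -[dsubmx c]vsubmxK r1 r2 r3 !col_mx0.
apply: leq_trans (leq_mul (leq_trans (subset_leq_card sub) (leq_card_bigcup _ _)) (leqnn _)) _.
rewrite big_distrl /= (eq_bigr (fun=> #|Assign|)) // sum_nat_const leq_mul2r; apply/orP; right.
apply: leq_trans (max_card _) _; rewrite card_FpM muln1 leq_exp2l ?prime_gt1 //.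
by rewrite !mulSn mul0n addn0.
Qed.

(** A union bound over two kinds of failure. The first inequality is Markov applied to
    [sum_expn_zeros]: each [d] has more than [T] zeros with probability at most [1 / (2 * p ^ m)].
    The second keeps the [p ^ (2 * n)] pairs, each failing with probability at most
    [p ^ (3 * k) / p ^ m], within a total of 1/2. *)
Lemma exists_assignment (A : {set X}) (T W : nat) :
  (2 < p)%N ->
  (2 * p ^ m * (p ^ k + W) ^ #|A| <= W.+1 ^ T.+1 * p ^ (k * #|A|))%N ->
  (2 * p ^ (2 * n + 3 * k) <= p ^ m)%N ->
  exists V : X -> 'M[F]_(m, k),
    (forall d : 'rV[F]_m, d != 0 -> (#|[set x in A | d *m V x == 0%R]| <= T)%N) /\
    (forall x d, d != 0 -> row_full (triple_mx V x d)).
Proof.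
move=> p2 H1 H2.
have p_gt0 : (0 < p)%N by apply: prime_gt0.
pose bad1 := \bigcup_(d : 'rV[F]_m | d != 0) [set v : Assign | (T < #|zeros A v d|)%N].
pose bad2 := \bigcup_(e : X * X | e.2 != 0) [set v : Assign | ~~ row_full (triple_mx v e.1 e.2)].
have Assign_gt0 : (0 < #|Assign|)%N by apply/card_gt0P; exists [ffun=> 0].
have le1 : (2 * #|bad1| < #|Assign|)%N.
  have cd (d : 'rV[F]_m) : d != 0 ->
      (2 * p ^ m * #|[set v : Assign | (T < #|zeros A v d|)%N]| <= #|Assign|)%N.
    move=> d0; set Bd := [set v | _].
    have markov : (#|Bd| * W.+1 ^ T.+1 <= \sum_(v : Assign) W.+1 ^ #|zeros A v d|)%N.
      rewrite -sum_nat_const big_mkcond /=; apply: leq_sum => v _.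
      by rewrite inE; case: ifP => // lt_T; rewrite leq_pexp2l.
    have := leq_mul markov (leqnn (p ^ (k * #|A|))).
    rewrite (sum_expn_zeros A W d0) -mulnA => le2.
    have pos : (0 < (p ^ k + W) ^ #|A|)%N by rewrite expn_gt0 addn_gt0 expn_gt0 p_gt0.
    rewrite -(leq_pmul2r pos) mulnAC; apply: leq_trans le2.
    by rewrite mulnC leq_mul2l H1 orbT.
  have : (p ^ m * (2 * #|bad1|) < p ^ m * #|Assign|)%N; last by rewrite ltn_pmul2l // expn_gt0 p_gt0.
  rewrite mulnA [(p ^ m * 2)%N]mulnC.
  apply: leq_ltn_trans (leq_mul (leqnn _) (leq_card_bigcup _ _)) _.
  rewrite big_distrr /=; apply: (@leq_ltn_trans (\sum_(d : 'rV[F]_m | d != 0%R) #|Assign|)%N).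
    by apply: leq_sum => d d0; apply: cd.
  (* Only [p ^ m - 1] differences are nonzero. This makes the bound strict, so the two failure
     probabilities add up to less than 1. *)
  rewrite sum_nat_const ltn_pmul2r // cardC1 card_FpM mul1n prednK ?leqnn ?expn_gt0 ?p_gt0 //.
have le2 : (2 * #|bad2| <= #|Assign|)%N.
  have pos : (0 < p ^ (2 * n + 3 * k))%N by rewrite expn_gt0 p_gt0.
  rewrite -(leq_pmul2l pos) mulnCA mulnA.
  apply: leq_trans (leq_mul H2 (leq_card_bigcup _ _)) _.
  rewrite big_distrr /=.
  apply: (@leq_trans (\sum_(e : X * X | e.2 != 0%R) p ^ (3 * k) * #|Assign|)%N).
    by apply: leq_sum => e e0; rewrite mulnC; apply: card_triple_dependent.
  rewrite sum_nat_const mulnA leq_mul2r; apply/orP; right.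
  rewrite expnD leq_mul2r; apply/orP; right.
  by apply: leq_trans (max_card _) _; rewrite card_prod card_FpM mul1n mul2n -addnn expnD.
have [v] : exists v : Assign, v \notin bad1 :|: bad2.
  apply/existsP; rewrite -negb_forall; apply/negP => /forallP all_bad.
  have : (#|Assign| <= #|bad1 :|: bad2|)%N by apply/subset_leq_card/subsetP => v _; apply: all_bad.
  move=> /leq_trans/(_ (leq_card_setU bad1 bad2)); rewrite -(leq_pmul2l (isT : 0 < 2)%N) mulnDr leqNgt.
  by move/negP; apply; have := leq_add le1 le2; rewrite addSn addnn -mul2n.
rewrite inE negb_or => /andP[/bigcupP n1 /bigcupP n2]; exists v; split=> [d d0|x d d0].
  by rewrite leqNgt; apply/negP => lt_T; case: n1; exists d => //; rewrite inE.
by apply/negPn/negP => nf; case: n2; exists (x, d) => //; rewrite inE.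
Qed.

End Counting.

(** * Behrend sets and the lifted set *)

Section Combi.
Local Open Scope ring_scope.
Variable p : nat.
Hypothesis p_pr : prime p.
Hypothesis p_gt2 : (2 < p)%N.
Local Notation F := 'F_p.

Definition ap3_set (n : nat) (A : {set 'rV[F]_n}) (d : 'rV[F]_n) : {set 'rV[F]_n} :=
  [set x | [&& x \in A, x + d \in A & x + (d + d) \in A]].

Definition ap_free (n : nat) (A : {set 'rV[F]_n}) :=
  forall x d, x \in A -> x + d \in A -> x + (d + d) \in A -> d = 0.

Lemma Fp_nat_inj (a b : nat) : (a < p)%N -> (b < p)%N -> a%:R = b%:R :> F -> a = b.
Proof.
move=> ap bp /(congr1 (fun z : F => nat_of_ord z)).
by rewrite !val_Fp_nat // !modn_small.
Qed.

Lemma pigeonhole_fiber (T : finType) (N s : nat) (f : T -> 'I_N) :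
  (0 < N)%N -> (0 < s)%N -> (s * N <= #|T|)%N -> exists r, (s <= #|[set x | f x == r]|)%N.
Proof.
move=> N0 s0 le_sN; apply/existsP; rewrite -[[exists _, _]]negbK negb_exists; apply/negP=> /forallP small.
have : (#|T| <= \sum_(r < N) s.-1)%N.
  rewrite -cardsT -sum1_card (partition_big f predT) //=; apply: leq_sum => r _.
  rewrite (eq_bigl (mem [set x | f x == r])) => [|x]; last by rewrite !inE.
  by rewrite sum1_card -ltnS prednK // ltnNge small.
rewrite sum_nat_const card_ord => /(leq_trans le_sN).
by rewrite mulnC leq_pmul2l // leqNgt prednK ?leqnn.
Qed.

(** Digits below [(p + 1) / 2] add without wrapping around, so progressions modulo [p] are
    progressions of integer vectors, and a sphere never contains the midpoint of two of its points.
    The factor [k * p ^ 2] bounds the number of possible squared norms. *)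
Lemma exists_ap_free (k s : nat) : (0 < k)%N -> (s * (k * p ^ 2) <= p.+1./2 ^ k)%N ->
  exists2 S : {set 'rV[F]_k}, #|S| = s & ap_free S.
Proof.
move=> k0 le_s; have [->|s0] := posnP s.
  by exists set0 => [|x d]; rewrite ?cards0 ?inE.
set q := p.+1./2 in le_s.
have q2 : (q.*2 <= p.+1)%N by rewrite -[leqRHS]odd_double_half leq_addl.
pose B := {ffun 'I_k -> 'I_q}.
pose nrm (g : B) := (\sum_i g i ^ 2)%N.
have nrm_lt g : (nrm g < k * p ^ 2)%N.
  apply: (@leq_ltn_trans (\sum_(i < k) q.-1 ^ 2)%N).
    apply: leq_sum => i _; rewrite leq_exp2r // -ltnS prednK ?ltn_ord //.
    exact: leq_ltn_trans (leq0n _) (ltn_ord (g i)).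
  rewrite sum_nat_const card_ord ltn_pmul2l // ltn_exp2r //; lia.
have [||r le_r] := @pigeonhole_fiber B _ s (fun g => Ordinal (nrm_lt g)) _ s0.
  by rewrite muln_gt0 k0 expn_gt0 prime_gt0.
  by rewrite card_ffun !card_ord.
(* Exactly [s] points of the sphere are kept, so that the density can be prescribed in the last
   lift. *)
have [sq [sq_uniq sq_size sq_sub]] := card_geqP le_r.
pose emb (g : B) : 'rV[F]_k := \row_i (g i : nat)%:R.
have lt_p (i : 'I_q) : (i < p)%N by have := ltn_ord i; lia.
have emb_inj : injective emb.
  move=> g h /rowP E; apply/ffunP => i; apply/val_inj/Fp_nat_inj; rewrite ?lt_p //.
  by have := E i; rewrite !mxE.
exists (emb @: [set x in sq]).
  by rewrite card_imset // cardsE (card_uniqP sq_uniq).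
move=> x d /imsetP[a]; rewrite inE => /sq_sub; rewrite inE => /eqP/(congr1 val) /= na ->.
move=> /imsetP[b]; rewrite inE => /sq_sub; rewrite inE => /eqP/(congr1 val) /= nb Eb.
move=> /imsetP[c]; rewrite inE => /sq_sub; rewrite inE => /eqP/(congr1 val) /= nc Ec.
(* Both sides are at most [p - 1], so equality modulo [p] is equality of integers. *)
have mid i : (a i + c i = b i + b i)%N.
  apply: Fp_nat_inj; try by have := ltn_ord (a i); have := ltn_ord (b i); have := ltn_ord (c i); lia.
  move: Ec; have -> : d = emb b - emb a by rewrite -Eb addrC addKr.
  move/rowP/(_ i); rewrite !mxE !natrD => <-.
  ring.
(* The parallelogram identity; with truncated subtraction the summand is the square of the distance
   between [a i] and [b i]. *)
have dist_sum : (nrm a + nrm c = nrm b + nrm b + (\sum_i ((a i - b i) + (b i - a i)) ^ 2).*2)%N.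
  rewrite /nrm -!big_split /= -mul2n big_distrr -big_split /=; apply: eq_bigr => i _.
  have := mid i; move: (a i : nat) (b i : nat) (c i : nat) => u v w.
  case: (leqP u v) => [/subnKC <-|/ltnW/subnKC <-]; lia.
have dist0 : (\sum_i ((a i - b i) + (b i - a i)) ^ 2)%N = 0%N by lia.
have ab : a = b.
  apply/ffunP => i; apply: val_inj => /=.
  by move/eqP: dist0; rewrite sum_nat_eq0 => /forallP/(_ i)/=; rewrite expn_eq0; lia.
by move: Eb; rewrite ab -{2}[emb b]addr0 => /addrI.
Qed.

Lemma card_pairs (n m : nat) (P : 'rV[F]_n -> 'rV[F]_m -> bool) :
  #|[set z : 'rV[F]_(n + m) | P (lsubmx z) (rsubmx z)]| = (\sum_x #|[set y | P x y]|)%N.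
Proof.
under [RHS]eq_bigr => x _ do rewrite -sum1dep_card.
rewrite pair_big_dep /= -sum1dep_card.
rewrite (reindex (fun u : 'rV[F]_n * 'rV[F]_m => row_mx u.1 u.2)) /=.
  by apply: eq_bigl => u; rewrite row_mxKl row_mxKr.
exists (fun z => (lsubmx z, rsubmx z)) => [[x y] _|z _] /=; first by rewrite row_mxKl row_mxKr.
by rewrite hsubmxK.
Qed.

Lemma card_prod_row (n m : nat) (S1 : {set 'rV[F]_n}) (S2 : {set 'rV[F]_m}) :
  #|[set z : 'rV[F]_(n + m) | (lsubmx z \in S1) && (rsubmx z \in S2)]| = (#|S1| * #|S2|)%N.
Proof.
rewrite (card_pairs (fun x y => (x \in S1) && (y \in S2))) -sum_nat_const big_mkcond.
rewrite [RHS]big_mkcond; apply: eq_bigr => x _ /=; case: (x \in S1) => /=.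
  by apply: eq_card => y; rewrite inE.
by apply: eq_card0 => y; rewrite inE.
Qed.

Lemma card_translate (n : nat) (S : {set 'rV[F]_n}) c : #|[set w | w + c \in S]| = #|S|.
Proof.
rewrite -(card_imset [set w | w + c \in S] (addIr c)); apply: eq_card => w.
apply/imsetP/idP => [[u]|wS]; first by rewrite inE => uS ->.
by exists (w - c); rewrite ?inE subrK.
Qed.

Lemma row_full_rowl (m k l : nat) (X : 'M[F]_(m, k)) (Y : 'M[F]_(m, l)) :
  row_full (row_mx X Y) -> row_full X.
Proof.
case/row_fullP=> B; rewrite mul_mx_row scalar_mx_block block_mxEh => BE.
apply/row_fullP; exists (usubmx B); rewrite mul_usub_mx.
by move/(congr1 lsubmx): BE; rewrite !row_mxKl => ->; rewrite col_mxKu.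
Qed.

Section Lift.
Variables (n m k : nat) (A : {set 'rV[F]_n}) (S : {set 'rV[F]_k}).
Variable V : 'rV[F]_n -> 'M[F]_(m, k).
Hypothesis S_free : ap_free S.
Hypothesis V_full : forall x d, d != 0 -> row_full (triple_mx V x d).
Hypothesis n_gt0 : (0 < n)%N.

Definition lift_set : {set 'rV[F]_(n + m)} :=
  [set z | (lsubmx z \in A) && (rsubmx z *m V (lsubmx z) \in S)].

Lemma card_lift_over (B : {set 'rV[F]_n}) :
  ((\sum_(x in B) #|[set y : 'rV[F]_m | y *m V x \in S]|) * p ^ k = #|B| * #|S| * p ^ m)%N.
Proof.
rewrite big_distrl /= -mulnA -sum_nat_const; apply: eq_bigr => x _.
(* Surjectivity of one [V x] is read off from a triple. The all-ones vector supplies a nonzero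
   direction because [n] is positive. *)
apply: card_preim_mulmx => //; apply: (@row_full_rowl _ _ (k + k)); apply: (V_full x (_ : const_mx 1 != 0)).
by apply/eqP => /rowP/(_ (Ordinal n_gt0)); rewrite !mxE => /eqP; rewrite oner_eq0.
Qed.

Lemma card_lift_set : (#|lift_set| * p ^ k = #|A| * #|S| * p ^ m)%N.
Proof.
rewrite -card_lift_over (card_pairs (fun x y => (x \in A) && (y *m V x \in S))).
congr (_ * _)%N; rewrite [RHS]big_mkcond; apply: eq_bigr => x _; case: (x \in A) => //=.
by apply: eq_card0 => y; rewrite inE.
Qed.

(** Over a fixed [x], the three membership conditions say that the image of [y] under the triple map
    lies in [C x], a product of [S] and two translates of [S]. The triple map is onto, so the count
    is exact. *)
Lemma card_ap3_lift_base (d : 'rV[F]_(n + m)) : lsubmx d != 0 ->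
  (#|ap3_set lift_set d| * p ^ (k + (k + k)) = #|ap3_set A (lsubmx d)| * (#|S| * (#|S| * #|S|)) * p ^ m)%N.
Proof.
move=> d0; set d1 := lsubmx d; set d2 := rsubmx d.
pose C x : {set 'rV[F]_(k + (k + k))} := [set w | (lsubmx w \in S) &&
  (rsubmx w \in [set w' | (lsubmx w' \in [set u | u + d2 *m V (x + d1) \in S]) &&
  (rsubmx w' \in [set u | u + (d2 + d2) *m V (x + (d1 + d1)) \in S])])].
have -> : #|ap3_set lift_set d| = (\sum_(x in ap3_set A d1) #|[set y | y *m triple_mx V x d1 \in C x]|)%N.
  have -> : ap3_set lift_set d = [set z | (lsubmx z \in ap3_set A d1) &&
      (rsubmx z *m triple_mx V (lsubmx z) d1 \in C (lsubmx z))].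
    apply/setP => z; rewrite !inE !mul_mx_row !row_mxKl !row_mxKr !linearD /= -/d1 -/d2 !mulmxDl.
    by rewrite row_mxKl; repeat (case: (_ \in _); rewrite ?andbF //=).
  rewrite (card_pairs (fun x y => (x \in ap3_set A d1) && (y *m triple_mx V x d1 \in C x))).
  rewrite [RHS]big_mkcond; apply: eq_bigr => x _; case: (x \in ap3_set A d1) => //=.
  by apply: eq_card0 => y; rewrite inE.
rewrite big_distrl /= -mulnA -sum_nat_const; apply: eq_bigr => x _.
by rewrite (card_preim_mulmx p_pr _ (V_full x d0)) /C !card_prod_row !card_translate.
Qed.

(** The three points lie over the same [x], and their images form a progression in [S] with
    difference [rsubmx d *m V x]. As [S] is free of progressions, this difference is 0. *)
Lemma card_ap3_lift_fiber (d : 'rV[F]_(n + m)) : d != 0 -> lsubmx d = 0 ->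
  (#|ap3_set lift_set d| * p ^ k <= #|[set x in A | rsubmx d *m V x == 0%R]| * #|S| * p ^ m)%N.
Proof.
move=> d0 d1; rewrite -card_lift_over leq_mul2r; apply/orP; right.
set Z := [set x in A | _].
have -> : (\sum_(x in Z) #|[set y | y *m V x \in S]| = #|[set z | (lsubmx z \in Z) && (rsubmx z *m V (lsubmx z) \in S)]|)%N.
  rewrite (card_pairs (fun x y => (x \in Z) && (y *m V x \in S))) [LHS]big_mkcond.
  apply: eq_bigr => x _; case: (x \in Z) => //=.
  by apply/esym/eq_card0 => y; rewrite inE.
apply/subset_leq_card/subsetP => z; rewrite !inE !linearD /= d1 !addr0 !mulmxDl.
case/and3P=> /andP[-> s0] /andP[_ s1] /andP[_ s2]; rewrite s0 andbT /=.
by apply/eqP; apply: (S_free s0 s1 s2).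
Qed.

End Lift.
End Combi.

(* The real numbers are imported only here because they rebind the scope key N. *)
From Stdlib Require Import Reals Lra.
From Stdlib Require Znat.

(** * The lifting step in terms of densities *)

Section Step.
Local Open Scope R_scope.

Lemma INR_expn (a b : nat) : INR (expn a b) = INR a ^ b.
Proof. by elim: b => [|b IH]; rewrite ?expn0 // expnS mult_INR IH. Qed.

Lemma pow_addn (x : R) (a b : nat) : x ^ (addn a b) = x ^ a * x ^ b.
Proof. exact: pow_add. Qed.

Lemma INR_leq (a b : nat) : leq a b -> INR a <= INR b.
Proof. by move=> /leP; apply: le_INR. Qed.

Lemma leq_INR (a b : nat) : INR a <= INR b -> leq a b.
Proof. by move=> /INR_le /leP. Qed.

Lemma INR_prime_gt0 (p : nat) : prime p -> 0 < INR p.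
Proof. by move=> /prime_gt0 /ltP /lt_0_INR. Qed.

Lemma nat_floor (x : R) : 0 <= x -> exists N : nat, INR N <= x < INR N + 1.
Proof.
move=> x0; have [i1 i2] := base_Int_part x.
have z0 : (0 <= Int_part x)%Z by apply/Z.lt_succ_r/lt_IZR; rewrite succ_IZR; lra.
by exists (Z.to_nat (Int_part x)); rewrite INR_IZR_INZ Znat.Z2Nat.id //; lra.
Qed.

Lemma nat_ceil (x : R) : 0 <= x -> exists N : nat, x <= INR N <= x + 1.
Proof. by move=> /nat_floor[N ?]; exists N.+1; rewrite S_INR; lra. Qed.

Lemma exp_INR_mul (N : nat) (x : R) : exp (INR N * x) = exp x ^ N.
Proof. 
elim: N => [|N IH]; first by rewrite Rmult_0_l exp_0.
by rewrite S_INR Rmult_plus_distr_r Rmult_1_l exp_plus IH /= Rmult_comm.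
Qed.

Lemma exp_mono (x y : R) : x <= y -> exp x <= exp y.
Proof. by case=> [/exp_increasing|->]; lra. Qed.

(** The bound is relative to the cube of the density: in base directions a lift multiplies both
    sides by [density S ^ 3], so [B] does not change. *)
Definition ap_bounded (B : R) (p n : nat) (A : {set 'rV['F_p]_n}) : Prop :=
  forall d : 'rV['F_p]_n, d != GRing.zero -> ap3_density A d <= B * density A ^ 3.

(** With [N * w / p ^ k <= T + 1] the moment costs at most [exp (T + 1) <= 3 ^ (T + 1)], while
    [w >= 6 * p] gains [(6 * p) ^ (T + 1)]. The quotient [(2 * p) ^ (T + 1)] covers [2 * p ^ m]. *)
Lemma moment_bound (p m k N T W0 : nat) (w : R) :
  0 < INR p -> INR m <= INR T + 1 -> INR W0 <= w < INR W0 + 1 -> 6 * INR p <= w ->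
  INR N * w / INR p ^ k <= INR T + 1 ->
  leq (2 * expn p m * expn (expn p k + W0) N)%nat (muln (expn W0.+1 T.+1) (expn p (muln k N))).
Proof.
move=> p0 mT W0w w6 Nw; apply: leq_INR.
rewrite !mult_INR !INR_expn plus_INR INR_expn (S_INR W0) (_ : INR 2 = 2) //.
have -> : INR p ^ (k * N)%nat = (INR p ^ k) ^ N by rewrite pow_mult.
have pk0 : 0 < INR p ^ k by apply: pow_lt.
have base : INR p ^ k + INR W0 <= INR p ^ k * exp (w / INR p ^ k).
  have := exp_ineq1_le (w / INR p ^ k) => /(Rmult_le_compat_l _ _ _ (Rlt_le _ _ pk0)).
  rewrite Rmult_plus_distr_l Rmult_1_r.
  have -> : INR p ^ k * (w / INR p ^ k) = w by field; lra.
  lra.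
have W00 := pos_INR W0.
have pw : (INR p ^ k + INR W0) ^ N <= (INR p ^ k) ^ N * exp (INR T + 1).
  apply: Rle_trans (pow_incr _ _ N _) _; first by split; [lra|exact: base].
  rewrite Rpow_mult_distr; apply: Rmult_le_compat_l; first by apply: pow_le; lra.
  rewrite -exp_INR_mul; apply: exp_mono.
  by move: Nw; rewrite /Rdiv Rmult_assoc.
have W_T : 2 * (INR p ^ T.+1 * exp (INR T + 1)) <= (INR W0 + 1) ^ T.+1.
  have -> : exp (INR T + 1) = exp 1 ^ T.+1 by rewrite -exp_INR_mul S_INR Rmult_1_r.
  rewrite -Rpow_mult_distr.
  apply: (Rle_trans _ ((2 * (INR p * 3)) ^ T.+1)).
    rewrite (Rpow_mult_distr 2); apply: Rmult_le_compat.
    - lra.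
    - by apply: pow_le; apply: Rmult_le_pos; [lra|apply: Rlt_le; apply: exp_pos].
    - by rewrite -{1}(pow_1 2); apply: Rle_pow; [lra|lia].
    - apply: pow_incr; split; first by apply: Rmult_le_pos; [lra|apply: Rlt_le; apply: exp_pos].
      by apply: Rmult_le_compat_l; [lra|apply: exp_le_3].
  by apply: pow_incr; lra.
have [p1|p1] : 1 <= INR p \/ INR p < 1 by lra.
  have pm : INR p ^ m <= INR p ^ T.+1.
    by apply: Rle_pow => //; apply: INR_le; rewrite S_INR.
  have e0 := exp_pos (INR T + 1).
  have pk : 0 < (INR p ^ k) ^ N by apply: pow_lt.
  have pm0 : 0 < INR p ^ m by apply: pow_lt.
  apply: (Rle_trans _ ((INR p ^ k) ^ N * (2 * (INR p ^ T.+1 * exp (INR T + 1))))).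
    apply: (Rle_trans _ (2 * INR p ^ m * ((INR p ^ k) ^ N * exp (INR T + 1)))).
      by apply: Rmult_le_compat_l => //; lra.
    have : 0 < (INR p ^ k) ^ N * exp (INR T + 1) by apply: Rmult_lt_0_compat.
    by move=> h; have := Rmult_le_compat_r _ _ _ (Rlt_le _ _ h) pm; lra.
  by rewrite [X in _ <= X]Rmult_comm; apply: Rmult_le_compat_l; lra.
by exfalso; have : (0 < p)%nat by [apply/ltP; apply: INR_lt; rewrite /=; lra]; move=> /INR_leq /=; lra.
Qed.

Lemma card_densityE (p n : nat) (A : {set 'rV['F_p]_n}) :
  prime p -> INR #|A| = density A * INR p ^ n.
Proof. by move=> /INR_prime_gt0 p0; rewrite /density; field; apply: pow_nonzero; lra. Qed.

Lemma card_ap3_densityE (p n : nat) (A : {set 'rV['F_p]_n}) d :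
  prime p -> INR #|ap3_set A d| = ap3_density A d * INR p ^ n.
Proof. by move=> /INR_prime_gt0 p0; rewrite /ap3_density /Rdiv Rmult_assoc Rinv_l ?Rmult_1_r //; apply: pow_nonzero; lra. Qed.

Section Lifting.
Variables (p n k : nat) (A : {set 'rV['F_p]_n}) (S : {set 'rV['F_p]_k}) (B : R).
Hypothesis p_pr : prime p.
Hypothesis p_gt2 : leq 3 p.
Hypothesis n_gt0 : leq 1 n.
Hypothesis A_bdd : ap_bounded B A.
Hypothesis S_free : ap_free S.

Lemma density_ge0 (r : nat) (C : {set 'rV['F_p]_r}) : 0 <= density C.
Proof.
apply: Rmult_le_pos; first exact: pos_INR.
by apply: Rlt_le; apply: Rinv_0_lt_compat; apply: pow_lt; apply: INR_prime_gt0.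
Qed.

(** The number [tau] of zeros is what fibre directions can afford: [tau * density S / p ^ n] equals
    [B * (density A * density S) ^ 3]. Taking [T] as its floor and [m = T + 1], the new dimension
    exceeds [tau], which is exponential in [n]. *)
Lemma lift_step :
  let tau := B * density A ^ 3 * density S ^ 2 * INR p ^ n in
  6 * INR p <= INR p ^ k * B * density A ^ 2 * density S ^ 2 ->
  2 * INR n + 3 * INR k + 1 <= tau ->
  exists n' (A' : {set 'rV['F_p]_n'}),
    [/\ tau <= INR n', density A' = density A * density S & ap_bounded B A'].
Proof.
move=> tau w6 tau_big.
(* This weight makes [#|A| * w / p ^ k] equal to [tau], as [moment_bound] asks. *)
set w := _ * _ * _ * _ in w6.
have P0 := INR_prime_gt0 p_pr.
have Pk r : 0 < INR p ^ r by apply: pow_lt.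
have n0 := pos_INR n; have k0 := pos_INR k.
have [T HT] : exists T : nat, INR T <= tau < INR T + 1 by apply: nat_floor; lra.
have [W0 HW] : exists W0 : nat, INR W0 <= w < INR W0 + 1 by apply: nat_floor; lra.
have dA := card_densityE A p_pr.
have dS := card_densityE S p_pr.
have H1 : leq (2 * expn p T.+1 * expn (expn p k + W0) #|A|)%nat (muln (expn W0.+1 T.+1) (expn p (muln k #|A|))).
  apply: moment_bound HW w6 _ => //; first by rewrite S_INR; lra.
  have -> : INR #|A| * w / INR p ^ k = tau by rewrite dA /w /tau; field; have := Pk k; lra.
  lra.
have H2 : leq (2 * expn p (2 * n + 3 * k))%nat (expn p T.+1).
  apply: (@leq_trans (expn p (2 * n + 3 * k).+1)).
    by rewrite expnS leq_mul2r; apply/orP; right; apply: ltnW.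
  rewrite leq_exp2l; last by apply: leq_trans p_gt2.
  apply: leq_INR; rewrite !S_INR plus_INR !mult_INR /=; lra.
have [V [Vz Vf]] := exists_assignment p_pr p_gt2 H1 H2.
exists (n + T.+1)%nat, (lift_set A S V).
have dL : density (lift_set A S V) = density A * density S.
  have := card_lift_set p_pr A S Vf n_gt0 => /(congr1 INR).
  rewrite !mult_INR !INR_expn dA dS => E.
  rewrite [density (lift_set _ _ _)]/density; apply: (Rmult_eq_reg_r (INR p ^ (n + T.+1) * INR p ^ k)); last first.
    by have := Rmult_lt_0_compat _ _ (Pk (n + T.+1)%nat) (Pk k); lra.
  transitivity (INR #|lift_set A S V| * INR p ^ k); first by field; have := Pk (n + T.+1)%nat; lra.
  by rewrite E pow_addn; ring.
split => //; first by rewrite plus_INR S_INR; lra.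
move=> d d0; rewrite dL.
have apE : INR #|ap3_set (lift_set A S V) d| = ap3_density (lift_set A S V) d * (INR p ^ n * INR p ^ T.+1).
  by rewrite -pow_addn; apply: card_ap3_densityE.
have dS0 := density_ge0 S.
have [d1|d1] := eqVneq (lsubmx d) GRing.zero.
  have := card_ap3_lift_fiber p_pr A S_free Vf n_gt0 d0 d1 => /INR_leq.
  have r0 : rsubmx d != GRing.zero.
    by apply: contra d0 => /eqP r0; rewrite -[d]hsubmxK d1 r0 row_mx0.
  have /INR_leq Z := Vz _ r0.
  rewrite !mult_INR !INR_expn apE dS => le_ap.
  have pos : 0 < INR p ^ n * INR p ^ T.+1 * INR p ^ k by do !apply: Rmult_lt_0_compat.
  apply: (Rmult_le_reg_r _ _ _ pos).
  apply: Rle_trans (_ : tau * (density S * INR p ^ k) * INR p ^ T.+1 <= _).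
    apply: Rle_trans (Rle_trans _ _ _ _ le_ap) _; first by rewrite -!Rmult_assoc; lra.
    apply: Rmult_le_compat_r; first exact: Rlt_le.
    apply: Rmult_le_compat_r; first by apply: Rmult_le_pos => //; apply: Rlt_le.
    apply: Rle_trans Z _; lra.
  by apply: Req_le; rewrite /tau; ring.
have := card_ap3_lift_base p_pr A S Vf d1 => /(congr1 INR).
rewrite !mult_INR !INR_expn apE dS => E.
have apA := card_ap3_densityE A (lsubmx d) p_pr.
have le_A := A_bdd d1.
have pos : 0 < INR p ^ n * INR p ^ T.+1 * INR p ^ (k + (k + k)) by do !apply: Rmult_lt_0_compat.
apply: (Rmult_le_reg_r _ _ _ pos).
apply: Rle_trans (_ : (B * density A ^ 3) * INR p ^ n * ((density S * INR p ^ k) * ((density S * INR p ^ k) * (density S * INR p ^ k))) * INR p ^ T.+1 <= _).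
  rewrite -Rmult_assoc E apA.
  apply: Rmult_le_compat_r; first exact: Rlt_le.
  apply: Rmult_le_compat_r; first by do !apply: Rmult_le_pos => //; apply: Rlt_le.
  by apply: Rmult_le_compat_r => //; apply: Rlt_le.
by apply: Req_le; rewrite !pow_addn; ring.
Qed.

End Lifting.
End Step.

(** * Numerical estimates *)

Section Numerics.
Local Open Scope R_scope.

Lemma ln_mono (x y : R) : 0 < x -> x <= y -> ln x <= ln y.
Proof. by move=> x0 [/(ln_increasing _ _ x0)|->]; lra. Qed.

Lemma ln_pow_nat (x : R) (n : nat) : 0 < x -> ln (x ^ n) = INR n * ln x.
Proof. by move=> x0; rewrite ln_pow. Qed.

(** Clearing denominators leaves a comparison of integers, which computation can decide. *)
Lemma ratio_pow_ge (x : R) (a b : Z) (n : nat) :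
  (0 < b)%Z -> x * IZR (b ^ Z.of_nat n) <= IZR (a ^ Z.of_nat n) -> x <= (IZR a / IZR b) ^ n.
Proof.
move=> /IZR_lt b0; rewrite -!pow_IZR => le_x.
have bn : 0 < IZR b ^ n by apply: pow_lt.
apply: (Rmult_le_reg_r (IZR b ^ n)) => //.
by rewrite -Rpow_mult_distr /Rdiv Rmult_assoc Rinv_l ?Rmult_1_r //; lra.
Qed.

Lemma ln2_le : ln 2 <= 0.7.
Proof.
rewrite -(ln_exp 0.7); apply: ln_mono; first lra.
have -> : 0.7 = INR 100 * 0.007 by rewrite INR_IZR_INZ /=; lra.
rewrite exp_INR_mul; apply: (Rle_trans _ ((1007 / 1000) ^ 100)).
  by apply: ratio_pow_ge => //; rewrite -mult_IZR; apply/IZR_le/Z.leb_le; vm_compute.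
by apply: pow_incr; split; [lra|have := exp_ineq1_le 0.007; lra].
Qed.

Lemma ln19_ge : 2.9 <= ln 19.
Proof.
suff : exp 2.9 <= 19 by move=> /(ln_mono (exp_pos _)); rewrite ln_exp.
have : / 19 <= exp (- 2.9).
  have -> : - 2.9 = INR 200 * (- 0.0145) by rewrite INR_IZR_INZ /=; lra.
  rewrite exp_INR_mul; apply: (Rle_trans _ ((9855 / 10000) ^ 200)).
    apply: ratio_pow_ge => //.
    suff : IZR (10000 ^ Z.of_nat 200) <= 19 * IZR (9855 ^ Z.of_nat 200) by lra.
    by rewrite -mult_IZR; apply/IZR_le/Z.leb_le; vm_compute.
  by apply: pow_incr; split; [lra|have := exp_ineq1_le (- 0.0145); lra].
rewrite (_ : - 2.9 = - (2.9)); last lra.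
rewrite exp_Ropp => /Rinv_le_contravar; rewrite !Rinv_inv; apply; lra.
Qed.

(** Since [exp 0.1 <= 3 / 2], a factor 3/2 between the two powers yields the margin 0.1. *)
Lemma ln_ratio_10_19 (a b : nat) :
  (3 * 19 ^ Z.of_nat b <=? 2 * 10 ^ Z.of_nat a)%Z = true -> 0.1 <= INR a * ln 10 - INR b * ln 19.
Proof.
move=> /Z.leb_le/IZR_le; rewrite !mult_IZR -!pow_IZR => le_ab.
have pb : 0 < 19 ^ b by apply: pow_lt; lra.
have e1 : exp 0.1 <= 3 / 2.
  have := exp_ineq1_le (- (0.1)); rewrite exp_Ropp => h.
  have e0 := exp_pos 0.1; have := Rmult_le_compat_l _ _ _ (Rlt_le _ _ e0) h.
  by rewrite Rinv_r; lra.
have : ln (exp 0.1 * 19 ^ b) <= ln (10 ^ a).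
  apply: ln_mono; first by apply: Rmult_lt_0_compat => //; apply: exp_pos.
  by have := Rmult_le_compat_r _ _ _ (Rlt_le _ _ pb) e1; lra.
rewrite ln_mult //; last exact: exp_pos.
by rewrite ln_exp !ln_pow_nat; lra.
Qed.

(* The digit set {0, .., (p-1)/2} has density exp (- digit_loss p) in F_p. *)
Definition digit_loss (P : R) : R := ln 2 + ln P - ln (P + 1).

Lemma digit_loss_le (P : R) : 0 < P -> digit_loss P <= 0.7.
Proof.
move=> P0; have : ln P <= ln (P + 1) by apply: ln_mono; lra.
by have := ln2_le; rewrite /digit_loss; lra.
Qed.

Lemma digit_loss_ge0 (P : R) : 1 <= P -> 0 <= digit_loss P.
Proof.
move=> P1; have : ln (P + 1) <= ln (2 * P) by apply: ln_mono; lra.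
by rewrite ln_mult /digit_loss; lra.
Qed.

(** This carries estimates from 19 to larger [P]. With [P = 19 * (1 + u)] one has
    [P + 1 = 20 * (1 + 0.95 * u)], and [(1 + u) ^ 4] is at most [(1 + 0.95 * u) ^ 5] coefficient by
    coefficient. *)
Lemma ln_succ_growth (P : R) : 19 <= P -> 4 * (ln P - ln 19) <= 5 * (ln (P + 1) - ln 20).
Proof.
move=> P19; pose u := P / 19 - 1.
have u0 : 0 <= u by rewrite /u; lra.
have -> : ln P = ln 19 + ln (1 + u).
  by rewrite -ln_mult; [congr ln; rewrite /u; lra | lra | lra].
have -> : ln (P + 1) = ln 20 + ln (1 + 0.95 * u).
  by rewrite -ln_mult; [congr ln; rewrite /u; lra | lra | lra].
have e4 : ln ((1 + u) ^ 4) = 4 * ln (1 + u) by rewrite ln_pow_nat /=; lra.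
have e5 : ln ((1 + 0.95 * u) ^ 5) = 5 * ln (1 + 0.95 * u) by rewrite ln_pow_nat /=; lra.
suff : ln ((1 + u) ^ 4) <= ln ((1 + 0.95 * u) ^ 5) by lra.
apply: ln_mono; first by apply: pow_lt; lra.
have u2 : 0 <= u * u by apply: Rmult_le_pos.
have u3 : 0 <= u * u * u by apply: Rmult_le_pos.
have u4 : 0 <= u * u * u * u by apply: Rmult_le_pos.
have u5 : 0 <= u * u * u * u * u by apply: Rmult_le_pos.
by rewrite /=; lra.
Qed.

(** The first lift uses a base of dimension [50 * j] and a Behrend set of dimension [39 * j]; its
    rank condition has leading cost [2 * 50 + 2 * 39 = 178] digit losses against [39 * ln P]. *)
Lemma digit_loss_base1 (P : R) : 19 <= P -> 0.1 <= 39 * ln P - 178 * digit_loss P.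
Proof.
move=> P19; have := ln_succ_growth P19.
have := @ln_ratio_10_19 178 139 (refl_equal true).
have : ln 19 <= ln P by apply: ln_mono; lra.
have -> : ln 20 = ln 2 + ln 10 by rewrite -ln_mult; [congr ln; lra | lra | lra].
by rewrite /digit_loss !INR_IZR_INZ /=; lra.
Qed.

(** The analogue for the dimension gained by the first lift: [3 * 50 + 2 * 39 = 228] losses against
    [50 * ln P]. *)
Lemma digit_loss_base2 (P : R) : 19 <= P -> 0.1 <= 50 * ln P - 228 * digit_loss P.
Proof.
move=> P19; have := ln_succ_growth P19.
have := @ln_ratio_10_19 228 178 (refl_equal true).
have : ln 19 <= ln P by apply: ln_mono; lra.
have -> : ln 20 = ln 2 + ln 10 by rewrite -ln_mult; [congr ln; lra | lra | lra].
by rewrite /digit_loss !INR_IZR_INZ /=; lra.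
Qed.

Lemma ln_le_linear (y : R) : 0 < y -> ln y <= y / 1000 + 6.
Proof.
move=> y0; have : ln (y / 1000) <= y / 1000 - 1.
  have := exp_ineq1_le (ln (y / 1000)); rewrite exp_ln; lra.
have -> : ln y = ln (y / 1000) + ln 1000 by rewrite -ln_mult; [congr ln; lra | lra | lra].
have : ln 1000 <= ln (2 ^ 10) by apply: ln_mono; lra.
by rewrite ln_pow_nat; [have := ln2_le; rewrite INR_IZR_INZ /=; lra | lra].
Qed.

Lemma exp_ge_cube (u : R) : 0 <= u -> u ^ 3 / 27 <= exp u.
Proof.
move=> u0; have -> : u = INR 3 * (u / 3) by rewrite INR_IZR_INZ /=; lra.
rewrite exp_INR_mul; have -> : (INR 3 * (u / 3)) ^ 3 / 27 = (u / 3) ^ 3 by rewrite INR_IZR_INZ /=; field.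
by apply: pow_incr; split; [lra | have := exp_ineq1_le (u / 3); lra].
Qed.

Lemma exp_add_ge (u v : R) : 0 <= u -> 0 <= v -> exp u + exp v - 1 <= exp (u + v).
Proof.
move=> u0 v0; rewrite exp_plus.
have a : 0 <= exp u - 1 by have := exp_ineq1_le u; lra.
have b : 0 <= exp v - 1 by have := exp_ineq1_le v; lra.
by have := Rmult_le_pos _ _ a b; lra.
Qed.

Lemma twelve_le_exp3 : 12 <= exp 3.
Proof.
have -> : 3 = INR 9 * (1 / 3) by rewrite INR_IZR_INZ /=; lra.
rewrite exp_INR_mul; apply: (Rle_trans _ ((4 / 3) ^ 9)); first lra.
by apply: pow_incr; split; [lra | have := exp_ineq1_le (1 / 3); lra].
Qed.

End Numerics.

(** * Iterating the lifting step *)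

Section Iteration.
Local Open Scope R_scope.
Variable p : nat.
Hypothesis p_pr : prime p.
Hypothesis p_ge19 : leq 19 p.
Local Notation P := (INR p).
Local Notation l := (ln (INR p)).

Lemma INR_p_ge19 : 19 <= P.
Proof. by have := INR_leq p_ge19; rewrite INR_IZR_INZ /=; lra. Qed.

Lemma ln_p_ge : 2.9 <= l.
Proof. by have := ln19_ge; have := @ln_mono 19 P; have := INR_p_ge19; lra. Qed.

Lemma p_gt2 : leq 3 p.
Proof. exact: leq_trans p_ge19. Qed.

Lemma pow_p_exp (k : nat) : P ^ k = exp (INR k * l).
Proof. by rewrite exp_INR_mul exp_ln //; apply: INR_prime_gt0. Qed.

Lemma exists_ap_free_size (k s : nat) :
  leq 1 k -> INR s * (INR k * P ^ 2) <= exp (INR k * (l - digit_loss P)) ->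
  exists2 S : {set 'rV['F_p]_k}, #|S| = s & ap_free S.
Proof.
move=> k0 le_s; apply: exists_ap_free => //; first exact: p_gt2.
apply: leq_INR; rewrite INR_expn mult_INR (mult_INR k) INR_expn; apply: (Rle_trans _ _ _ le_s).
rewrite exp_INR_mul; apply: Req_le; congr pow.
have P19 := INR_p_ge19; have l2 : exp (ln 2) = 2 by apply: exp_ln; lra.
have -> : l - digit_loss P = ln (P + 1) + - ln 2 by rewrite /digit_loss; lra.
rewrite exp_plus exp_Ropp l2 exp_ln; last lra.
have p_odd : odd p by case: (even_prime p_pr) => // p2; move: p_ge19; rewrite p2.
have : p.+1 = addn (p.+1)./2 (p.+1)./2 by rewrite addnn -[LHS]odd_double_half /= p_odd.
by move/(congr1 INR); rewrite plus_INR S_INR; lra.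
Qed.

(** In the lower bound on [y], [ln (INR k) + 2 * l] pays for the choice of a norm and [ln 2] for
    rounding the size up; [y <= INR k * l] makes that size at least 1, so rounding at most doubles
    it. *)
Lemma exists_ap_free_dense (k : nat) (y : R) :
  leq 1 k -> y <= INR k * l -> INR k * digit_loss P + ln 2 + ln (INR k) + 2 * l <= y ->
  exists2 S : {set 'rV['F_p]_k}, ap_free S & exp (- y) <= density S.
Proof.
move=> k0 yk le_y; have P0 := INR_prime_gt0 p_pr.
have kR : 0 < INR k by apply: lt_0_INR; apply/ltP.
have e1 : 1 <= exp (INR k * l - y) by have := exp_ineq1_le (INR k * l - y); lra.
have [|s [s1 s2]] := @nat_ceil (exp (INR k * l - y)); first lra.
have [|S Ss S_free] := @exists_ap_free_size k s k0.
  have -> : INR k * P ^ 2 = exp (ln (INR k) + 2 * l).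
    by rewrite exp_plus exp_ln // pow_p_exp.
  apply: (Rle_trans _ (2 * exp (INR k * l - y) * exp (ln (INR k) + 2 * l))).
    by apply: Rmult_le_compat_r; [apply/Rlt_le/exp_pos | lra].
  rewrite -{1}(exp_ln 2); last lra.
  rewrite -!exp_plus; apply: exp_mono; lra.
exists S => //; rewrite /density Ss; have Pk : 0 < P ^ k by apply: pow_lt.
apply: (Rmult_le_reg_r (P ^ k)) => //.
rewrite /Rdiv Rmult_assoc Rinv_l ?Rmult_1_r; last lra.
by rewrite pow_p_exp -exp_plus; rewrite Rplus_comm; apply: s1.
Qed.

Lemma density_le1 (n : nat) (A : {set 'rV['F_p]_n}) : density A <= 1.
Proof.
have Pn : 0 < P ^ n by apply: pow_lt; apply: INR_prime_gt0.
apply: (Rmult_le_reg_r (P ^ n)) => //.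
rewrite -card_densityE // Rmult_1_l -INR_expn; apply: INR_leq.
by apply: leq_trans (max_card _) _; rewrite card_FpM // mul1n.
Qed.

(** [lift_step] on a logarithmic scale. The term [l + 3] absorbs [12 * P], and the final [- 1] in
    [E] absorbs the factor 1/2 in the bound. *)
Lemma lift_step_exp (n k : nat) (kap a y : R) (A : {set 'rV['F_p]_n}) (S : {set 'rV['F_p]_k}) :
  leq 1 n -> ap_bounded (exp (- kap) / 2) A -> ap_free S ->
  exp (- a) <= density A -> exp (- y) <= density S ->
  kap + 2 * a + 2 * y + l + 3 <= INR k * l ->
  let E := INR n * l - kap - 3 * a - 2 * y - 1 in
  2 * INR n + 3 * INR k + 1 <= exp E ->
  exists n' (A' : {set 'rV['F_p]_n'}),
    [/\ exp E <= INR n', density A' = density A * density S & ap_bounded (exp (- kap) / 2) A'].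
Proof.
move=> n0 A_bdd S_free A_dense S_dense le_k E le_E.
have ek := exp_pos (- kap); have ea := exp_pos (- a); have ey := exp_pos (- y).
have A3 : exp (- a) ^ 3 <= density A ^ 3 by apply: pow_incr; lra.
have A2 : exp (- a) ^ 2 <= density A ^ 2 by apply: pow_incr; lra.
have S2 : exp (- y) ^ 2 <= density S ^ 2 by apply: pow_incr; lra.
have a3 : 0 <= exp (- a) ^ 3 by apply: pow_le; lra.
have a2 : 0 <= exp (- a) ^ 2 by apply: pow_le; lra.
have y2 : 0 <= exp (- y) ^ 2 by apply: pow_le; lra.
have B0 : 0 <= exp (- kap) / 2 by lra.
have Pn : 0 < P ^ n by apply: pow_lt; apply: INR_prime_gt0.
have Pk : 0 < P ^ k by apply: pow_lt; apply: INR_prime_gt0.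
have tauE : exp E <= exp (- kap) / 2 * density A ^ 3 * density S ^ 2 * P ^ n.
  apply: (Rle_trans _ (exp (- kap) / 2 * exp (- a) ^ 3 * exp (- y) ^ 2 * P ^ n)); last first.
    apply: Rmult_le_compat_r; first lra.
    apply: Rmult_le_compat => //; first by apply: Rmult_le_pos.
    by apply: Rmult_le_compat_l.
  rewrite -!exp_INR_mul pow_p_exp.
  have -> : exp E = exp (- kap) * exp (- (1)) * exp (INR 3 * - a) * exp (INR 2 * - y) * exp (INR n * l).
    by rewrite -!exp_plus; congr exp; rewrite /E !INR_IZR_INZ /=; lra.
  do 3 (apply: Rmult_le_compat_r; first by apply/Rlt_le/exp_pos).
  apply: Rmult_le_compat_l; first lra.
  by rewrite exp_Ropp; apply: Rinv_le_contravar; [lra | have := exp_ineq1_le 1; lra].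
have wE : 6 * P <= P ^ k * (exp (- kap) / 2) * density A ^ 2 * density S ^ 2.
  apply: (Rle_trans _ (P ^ k * (exp (- kap) / 2) * exp (- a) ^ 2 * exp (- y) ^ 2)); last first.
    have h : 0 <= P ^ k * (exp (- kap) / 2) by apply: Rmult_le_pos; lra.
    apply: Rmult_le_compat => //; first by apply: Rmult_le_pos.
    by apply: Rmult_le_compat_l.
  rewrite -!exp_INR_mul pow_p_exp.
  suff : 12 * P <= exp (INR k * l) * exp (- kap) * exp (INR 2 * - a) * exp (INR 2 * - y) by lra.
  rewrite -!exp_plus; apply: (Rle_trans _ (exp (3 + l))); last first.
    by apply: exp_mono; rewrite (INR_IZR_INZ 2) /=; lra.
  have P0 := INR_prime_gt0 p_pr.
  rewrite exp_plus exp_ln //; apply: Rmult_le_compat_r; first lra.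
  exact: twelve_le_exp3.
have [|n' [A' [n'E dA' A'_bdd]]] := lift_step p_pr p_gt2 n0 A_bdd S_free wE; first lra.
by exists n', A'; split => //; lra.
Qed.

(** Here [exp kap] is K. The factor 1/2 is room for the overshoot of the density at the end. *)
Definition reachable (kap : R) (n : nat) (a : R) : Prop :=
  exists2 A : {set 'rV['F_p]_n}, exp (- a) <= density A & ap_bounded (exp (- kap) / 2) A.

Lemma quadratic_le_exp (u : R) : 80 <= u -> u ^ 2 <= exp u.
Proof.
move=> u80; have u2 : 0 <= u ^ 2 by apply: pow_le; lra.
apply: Rle_trans (exp_ge_cube _); last lra.
have := Rmult_le_compat_r _ _ _ u2 u80; rewrite /=; lra.
Qed.

Lemma reachable_base (kap : R) (j : nat) : 50 * l <= kap -> 1000 * kap <= INR j ->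
  exists2 n, reachable kap n (70 * INR j) & exp kap + 4 * (70 * INR j) <= INR n.
Proof.
move=> kapl kapj; have l29 := ln_p_ge; have P19 := INR_p_ge19.
have jR : 145000 <= INR j by lra.
have j0 : leq 1 j by apply: leq_INR; rewrite /=; lra.
set x := digit_loss P.
have x0 : 0 <= x by apply: digit_loss_ge0; lra.
have x7 : x <= 0.7 by apply: digit_loss_le; lra.
have b1 := digit_loss_base1 P19; have b2 := digit_loss_base2 P19; rewrite -/x in b1 b2.
have jx : INR j * x <= INR j * 0.7 by apply: Rmult_le_compat_l; lra.
have jx0 : 0 <= INR j * x by apply: Rmult_le_pos; lra.
have jb1 := Rmult_le_compat_l (INR j) _ _ ltac:(lra) b1.
have jb2 := Rmult_le_compat_l (INR j) _ _ ltac:(lra) b2.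
have ln2 := ln2_le.
have c50 : INR (50 * j)%nat = 50 * INR j by rewrite mult_INR; congr (_ * _); rewrite INR_IZR_INZ.
have c39 : INR (39 * j)%nat = 39 * INR j by rewrite mult_INR; congr (_ * _); rewrite INR_IZR_INZ.
have ln_j := @ln_le_linear (INR j) ltac:(lra).
have ln50 : ln (50 * INR j) <= INR j / 1000 + 11.
  have : ln 50 <= ln (2 ^ 6) by apply: ln_mono; lra.
  rewrite ln_pow_nat; last lra.
  by rewrite ln_mult; [rewrite INR_IZR_INZ /=; lra | lra | lra].
have ln39 : ln (39 * INR j) <= ln (50 * INR j) by apply: ln_mono; lra.
have jl : INR j * 2.9 <= INR j * l by apply: Rmult_le_compat_l; lra.
(* The terms [0.01 * INR j] dominate the logarithmic costs of Behrend's construction, since [j] is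
   at least 145000 and [l] is tiny compared with it. *)
pose y0 := 50 * INR j * x + 0.01 * INR j.
pose y1 := 39 * INR j * x + 0.01 * INR j.
have n0 : leq 1 (50 * j)%nat by rewrite muln_gt0.
have [| |A A_free A_dense] := @exists_ap_free_dense (50 * j)%nat y0 n0.
- by rewrite c50 /y0; lra.
- by rewrite c50 -/x /y0; lra.
have [| | |S S_free S_dense] := @exists_ap_free_dense (39 * j)%nat y1.
- by rewrite muln_gt0.
- by rewrite c39 /y1; lra.
- by rewrite c39 -/x /y1; lra.
(* A set free of progressions meets the bound trivially, its counts being 0. *)
have A_bdd : ap_bounded (exp (- kap) / 2) A.
  move=> d d0; have -> : ap3_density A d = 0.
    have ap0 : #|ap3_set A d| = O.
      apply: eq_card0 => z; rewrite inE; apply/negP => /and3P[z0 z1 z2].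
      by move/eqP: d0; apply; apply: A_free z0 z1 z2.
    rewrite /ap3_density -[X in INR X / _]/(#|ap3_set A d|) ap0 /=; lra.
  apply: Rmult_le_pos; first by have := exp_pos (- kap); lra.
  by apply: pow_le; apply: density_ge0.
have := lift_step_exp n0 A_bdd S_free A_dense S_dense.
rewrite c50 c39; cbv zeta; set E := (X in _ <= exp X).
have E_ge : kap + 0.04 * INR j <= E by rewrite /E /y0 /y1; lra.
have cube : 280 * INR j + 1 <= exp (0.04 * INR j).
  apply: Rle_trans (exp_ge_cube _); last lra.
  have : 145000 * INR j <= INR j * INR j by apply: Rmult_le_compat_r; lra.
  have : 145000 * (INR j * INR j) <= INR j * (INR j * INR j).
    by apply: Rmult_le_compat_r; [apply: Rmult_le_pos|]; lra.
  rewrite /=; lra.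
have expE : exp kap + 280 * INR j <= exp E.
  apply: Rle_trans (exp_mono E_ge).
  by apply: Rle_trans (exp_add_ge _ _); lra.
case=> [||n' [A' [n'E dA' A'_bdd]]].
- by rewrite /y0 /y1; lra.
- by have := exp_ineq1_le kap; lra.
rewrite -/E in n'E.
exists n'; last lra.
exists A' => //; rewrite dA'.
apply: (Rle_trans _ (exp (- y0) * exp (- y1))); last first.
  by apply: Rmult_le_compat => //; apply/Rlt_le/exp_pos.
by rewrite -exp_plus; apply: exp_mono; rewrite /y0 /y1; lra.
Qed.

(** Take [k] close to [5 * a / l]: then [p ^ k] is about [exp (5 * a)], enough for the rank
    condition, and the density loss [0.75 * k] is at most [4.5 / l * a]. The slack [4 * a] in the
    dimension pays for the losses in [E] and leaves [5 * a], whose exponential restores the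
    slack. *)
Lemma reachable_iterate (kap a t g : R) (n : nat) :
  50 * l <= kap -> l * l <= kap -> 1000 * kap <= a -> 0 <= t ->
  1 + 4.5 / l <= g -> g <= exp 9 ->
  reachable kap n a -> t + 4 * a <= INR n ->
  exists2 n', reachable kap n' (g * a) & exp (t * l) + 4 * (g * a) <= INR n'.
Proof.
move=> kapl kapll kapa t0 g1 g9 [A A_dense A_bdd] n_ge.
have l29 := ln_p_ge; have P19 := INR_p_ge19; have ln2 := ln2_le.
have [|k [k1 k2]] := @nat_ceil (5 * a / l).
  by apply: Rmult_le_pos; [lra | apply/Rlt_le/Rinv_0_lt_compat; lra].
have kl1 : 5 * a <= INR k * l.
  have := Rmult_le_compat_r l _ _ ltac:(lra) k1.
  by rewrite /Rdiv Rmult_assoc Rinv_l ?Rmult_1_r; lra.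
have kl2 : INR k * l <= 6 * a.
  have := Rmult_le_compat_r l _ _ ltac:(lra) k2.
  by rewrite Rmult_plus_distr_r /Rdiv Rmult_assoc Rinv_l ?Rmult_1_r; lra.
(* This uses [l * l <= kap]; it makes the [2 * l] in Behrend's bound negligible against [k]. *)
have k_ge : 5000 * l <= INR k.
  apply: (Rmult_le_reg_r l); first lra.
  lra.
have kR : 0 <= INR k by apply: pos_INR.
have kl3 : INR k * 2.9 <= INR k * l by apply: Rmult_le_compat_l; lra.
have k250 : 250000 <= INR k.
  by apply: (Rmult_le_reg_r l); lra.
have k0 : leq 1 k by apply: leq_INR; rewrite /=; lra.
have x7 : digit_loss P <= 0.7 by apply: digit_loss_le; lra.
have kx : INR k * digit_loss P <= INR k * 0.7 by apply: Rmult_le_compat_l; lra.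
have ln_k := @ln_le_linear (INR k) ltac:(lra).
have [| |S S_free S_dense] := @exists_ap_free_dense k (0.75 * INR k) k0; [lra | lra |].
have n0 : leq 1 n by apply: leq_INR; rewrite /=; lra.
have nl : (t + 4 * a) * l <= INR n * l by apply: Rmult_le_compat_r; lra.
have al : a * 2.9 <= a * l by apply: Rmult_le_compat_l; lra.
have nl2 : INR n * 2.9 <= INR n * l by apply: Rmult_le_compat_l; lra.
have tl : 0 <= t * l by apply: Rmult_le_pos; lra.
have := lift_step_exp n0 A_bdd S_free A_dense S_dense.
cbv zeta; set E := (X in _ <= exp X).
have E1 : t * l + 5 * a <= E by rewrite /E; lra.
have E2 : INR n <= E by rewrite /E; lra.
have expE2 : 5 * INR n <= exp E.
  apply: Rle_trans (exp_mono E2).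
  apply: Rle_trans (quadratic_le_exp _); last lra.
  rewrite /= Rmult_1_r; apply: Rmult_le_compat_r; lra.
have exp5a : 1 + 4 * (g * a) <= exp (5 * a).
  have -> : 5 * a = 9 + (5 * a - 9) by lra.
  rewrite exp_plus; apply: (Rle_trans _ (exp 9 * (5 * a))).
    have e9 := exp_ineq1_le 9.
    have : g * a <= exp 9 * a by apply: Rmult_le_compat_r; lra.
    have : 1 * a <= exp 9 * a by apply: Rmult_le_compat_r; lra.
    lra.
  apply: Rmult_le_compat_l; first by apply/Rlt_le/exp_pos.
  apply: Rle_trans (quadratic_le_exp _); last lra.
  have : 80 * (5 * a - 9) <= (5 * a - 9) * (5 * a - 9) by apply: Rmult_le_compat_r; lra.
  rewrite /=; lra.
case=> [||n' [A' [n'E dA' A'_bdd]]]; [lra | lra |]; rewrite -/E in n'E.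
exists n'; last first.
  have := @exp_add_ge (t * l) (5 * a) tl ltac:(lra); have := exp_mono E1; lra.
exists A' => //; rewrite dA'.
apply: (Rle_trans _ (exp (- a) * exp (- (0.75 * INR k)))); last first.
  by apply: Rmult_le_compat => //; apply/Rlt_le/exp_pos.
rewrite -exp_plus; apply: exp_mono.
have ga : (1 + 4.5 / l) * a <= g * a by apply: Rmult_le_compat_r; lra.
have : 0.75 * INR k <= 4.5 / l * a; last lra.
apply: (Rmult_le_reg_r l); first lra.
have -> : 4.5 / l * a * l = 4.5 * a by field; lra.
lra.
Qed.

(** The size of [S] is chosen from the actual density [exp (- b)] of [A], to aim at [exp (- a)]. The
    rank condition costs [2 * b + 2 * (a - b) = 2 * a], hence [k] close to [2.1 * a / l]; and
    [b <= 0.4 * a] leaves [S] a loss of at least [0.6 * a], more than Behrend's construction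
    needs. *)
Lemma reachable_final (kap a t : R) (n : nat) :
  50 * l <= kap -> 1000 * kap <= 0.4 * a -> 0 <= t ->
  reachable kap n (0.4 * a) -> t + 4 * (0.4 * a) <= INR n ->
  exists n' (A : {set 'rV['F_p]_n'}),
    [/\ exp (t * l) <= INR n', exp (- a) <= density A, density A <= 1.1 * exp (- a)
      & ap_bounded (exp (- kap) / 2) A].
Proof.
move=> kapl kapa t0 [A A_dense A_bdd] n_ge.
have l29 := ln_p_ge; have P19 := INR_p_ge19; have ln2 := ln2_le.
have dA0 : 0 < density A by have := exp_pos (- (0.4 * a)); lra.
have dA1 := density_le1 A.
pose b := - ln (density A).
have eb : exp (- b) = density A by rewrite /b Ropp_involutive exp_ln.
have b1 : b <= 0.4 * a.
  by have := ln_mono (exp_pos _) A_dense; rewrite ln_exp /b; lra.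
have b0 : 0 <= b by have := ln_mono dA0 dA1; rewrite ln_1 /b; lra.
have [|k [k1 k2]] := @nat_ceil (2.1 * a / l).
  by apply: Rmult_le_pos; [lra | apply/Rlt_le/Rinv_0_lt_compat; lra].
have kl1 : 2.1 * a <= INR k * l.
  have := Rmult_le_compat_r l _ _ ltac:(lra) k1.
  by rewrite /Rdiv Rmult_assoc Rinv_l ?Rmult_1_r; lra.
have kl2 : INR k * l <= 2.2 * a.
  have := Rmult_le_compat_r l _ _ ltac:(lra) k2.
  by rewrite Rmult_plus_distr_r /Rdiv Rmult_assoc Rinv_l ?Rmult_1_r; lra.
have kR : 0 <= INR k by apply: pos_INR.
have kl3 : INR k * 2.9 <= INR k * l by apply: Rmult_le_compat_l; lra.
have k250 : 100000 <= INR k.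
  by apply: (Rmult_le_reg_r l); lra.
have k0 : leq 1 k by apply: leq_INR; rewrite /=; lra.
have x7 : digit_loss P <= 0.7 by apply: digit_loss_le; lra.
have kx : INR k * digit_loss P <= INR k * 0.7 by apply: Rmult_le_compat_l; lra.
have ln_k := @ln_le_linear (INR k) ltac:(lra).
pose r := exp (INR k * l - (a - b)).
have r1 : 1 <= r by have := exp_ineq1_le (INR k * l - (a - b)); rewrite /r; lra.
have [|s [s1 s2]] := @nat_ceil r; first lra.
have [|S Ss S_free] := @exists_ap_free_size k s k0.
  have -> : INR k * P ^ 2 = exp (ln (INR k) + 2 * l).
    by rewrite exp_plus exp_ln ?pow_p_exp //; lra.
  apply: (Rle_trans _ (2 * r * exp (ln (INR k) + 2 * l))).
    by apply: Rmult_le_compat_r; [apply/Rlt_le/exp_pos | lra].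
  rewrite -{1}(exp_ln 2); last lra.
  rewrite -!exp_plus; apply: exp_mono; lra.
have Pk : 0 < P ^ k by apply: pow_lt; lra.
have dSE : density S * P ^ k = INR s by rewrite -card_densityE // Ss.
have ePk := pow_p_exp k.
have S_dense : exp (- (a - b)) <= density S.
  apply: (Rmult_le_reg_r (P ^ k)) => //; rewrite dSE ePk -exp_plus.
  have -> : - (a - b) + INR k * l = INR k * l - (a - b) by lra.
  exact: s1.
(* Rounding adds at most one point to [S], that is [1 / p ^ k] to its density, which is below a
   tenth of [exp (- a)]. *)
have S_dense2 : density S <= exp (- (a - b)) + exp (- (INR k * l)).
  apply: (Rmult_le_reg_r (P ^ k)) => //; rewrite dSE ePk Rmult_plus_distr_r -!exp_plus.
  have -> : - (a - b) + INR k * l = INR k * l - (a - b) by lra.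
  have -> : - (INR k * l) + INR k * l = 0 by lra.
  by rewrite exp_0 -/r; lra.
have n0 : leq 1 n by apply: leq_INR; rewrite /=; lra.
have nl : (t + 4 * (0.4 * a)) * l <= INR n * l by apply: Rmult_le_compat_r; lra.
have al : a * 2.9 <= a * l by apply: Rmult_le_compat_l; lra.
have nl2 : INR n * 2.9 <= INR n * l by apply: Rmult_le_compat_l; lra.
have A_dense' : exp (- b) <= density A by lra.
have := lift_step_exp n0 A_bdd S_free A_dense' S_dense.
cbv zeta; set E := (X in _ <= exp X).
have E1 : t * l <= E by rewrite /E; lra.
have E2 : INR n <= E by rewrite /E; lra.
have expE2 : 5 * INR n <= exp E.
  apply: Rle_trans (exp_mono E2).
  apply: Rle_trans (quadratic_le_exp _); last lra.
  rewrite /= Rmult_1_r; apply: Rmult_le_compat_r; lra.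
case=> [||n' [A' [n'E dA' A'_bdd]]]; [lra | lra |]; rewrite -/E in n'E.
have eab : density A * exp (- (a - b)) = exp (- a).
  by rewrite -eb -exp_plus; congr exp; lra.
exists n', A'; split => //.
- by have := exp_mono E1; lra.
- by rewrite dA' -eab; apply: Rmult_le_compat_l; lra.
rewrite dA'; apply: (Rle_trans _ (density A * (exp (- (a - b)) + exp (- (INR k * l))))).
  by apply: Rmult_le_compat_l; lra.
rewrite Rmult_plus_distr_l eab.
have : density A * exp (- (INR k * l)) <= 1 * exp (- (INR k * l)).
  by apply: Rmult_le_compat_r => //; apply/Rlt_le/exp_pos.
have : exp (- (INR k * l)) <= exp (- a + - (10)) by apply: exp_mono; lra.
rewrite exp_plus.
have : exp (- (10)) <= 0.1.
  rewrite exp_Ropp; have := exp_ineq1_le 10 => h.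
  have -> : 0.1 = / 10 by lra.
  by apply: Rinv_le_contravar; lra.
move=> /(Rmult_le_compat_l (exp (- a)) _ _ (Rlt_le _ _ (exp_pos _))); lra.
Qed.

End Iteration.

(** * Assembling the tower *)

Section Tower.
Local Open Scope R_scope.

Lemma Tow_ge0 (b r : R) (i : nat) : 0 <= r -> 0 <= Tow b i r.
Proof. by case: i => [|i] //= _; apply/Rlt_le/exp_pos. Qed.

Lemma reachable_tower (p : nat) (kap a K g : R) :
  prime p -> leq 19 p ->
  50 * ln (INR p) <= kap -> ln (INR p) * ln (INR p) <= kap -> 1000 * kap <= a -> 0 <= K ->
  1 + 4.5 / ln (INR p) <= g -> g <= exp 9 ->
  (exists2 n, reachable p kap n a & K + 4 * a <= INR n) ->
  forall i, exists2 n, reachable p kap n (g ^ i * a) & Tow (INR p) i K + 4 * (g ^ i * a) <= INR n.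
Proof.
move=> p_pr p19 kapl kapll kapa K0 g1 g9 base; elim=> [|i [n n_reach n_ge]].
  by rewrite /= Rmult_1_l.
have l29 := ln_p_ge p19.
have g_ge1 : 1 <= g.
  have : 0 < 4.5 / ln (INR p) by apply: Rdiv_lt_0_compat; lra.
  lra.
have gi : 1 * a <= g ^ i * a.
  by apply: Rmult_le_compat_r; [lra | apply: pow_R1_Rle].
have [|n' n'_reach n'_ge] := reachable_iterate p_pr p19 kapl kapll _ (Tow_ge0 (INR p) i K0) g1 g9 n_reach n_ge.
  lra.
by exists n'; rewrite /= Rmult_assoc // /Rpower; lra.
Qed.

(* Spreading the increase of the exponent evenly over all steps but the last makes it end
   exactly at ratio, large enough for the dimension bound of the last step. *)
Lemma growth_factor (l ratio L a1 : R) (N : nat) :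
  2.9 <= l -> 133 <= L -> 0 < a1 ->
  0.9 * L <= ln (ratio / a1) <= L -> 0 < ratio -> 0.12 * L <= INR N -> INR N <= l * L / 15 ->
  exists g, [/\ 1 + 4.5 / l <= g, g <= exp 9 & g ^ N * a1 = ratio].
Proof.
move=> l29 L133 a10 [r1 r2] r0 N1 N2.
have N0 : 0 < INR N by lra.
exists (exp (ln (ratio / a1) / INR N)); split.
- apply: Rle_trans (exp_ineq1_le _); apply: Rplus_le_compat_l.
  apply: (Rmult_le_reg_r (INR N)) => //.
  have -> : ln (ratio / a1) / INR N * INR N = ln (ratio / a1) by field; lra.
  apply: (Rle_trans _ (4.5 / l * (l * L / 15))).
    by apply: Rmult_le_compat_l => //; apply/Rlt_le/Rdiv_lt_0_compat; lra.
  have -> : 4.5 / l * (l * L / 15) = 4.5 * L / 15 by field; lra.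
  lra.
- apply: exp_mono; apply: (Rmult_le_reg_r (INR N)) => //.
  by rewrite /Rdiv Rmult_assoc Rinv_l ?Rmult_1_r; lra.
rewrite -exp_INR_mul; have -> : INR N * (ln (ratio / a1) / INR N) = ln (ratio / a1) by field; lra.
by rewrite exp_ln; [field; lra | apply: Rdiv_lt_0_compat].
Qed.
(** The exponent of the density is [70 * j] after the base step, [0.4 * as_] after [h] iterations
    and [as_] after the final lift. That lift supplies the last level of a tower of height
    [h + 1]. *)
Lemma tower_construction (p : nat) (alpha kap : R) :
  prime p -> leq 19 p -> 0 < alpha ->
  50 * ln (INR p) <= kap -> ln (INR p) * ln (INR p) <= kap -> exp 133 * kap <= - ln alpha ->
  exists (n : nat) (A : {set 'rV['F_p]_n}),
    [/\ TowR (INR p) (/ 30 * log2 (INR p) * ln (- ln alpha / kap)) (exp kap) <= INR n,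
        alpha <= density A, density A <= 1.1 * alpha & ap_bounded (exp (- kap) / 2) A].
Proof.
move=> p_pr p19 a0 kap50 kapll kap_up.
have l29 := ln_p_ge p19.
set l := ln (INR p) in l29 kap50 kapll *.
have ln2_up := ln2_le; have ln2_lo := ln_lt_2.
set as_ := - ln alpha in kap_up *.
have e_as : exp (- as_) = alpha by rewrite /as_ Ropp_involutive exp_ln.
have kap0 : 0 < kap by lra.
have K0 : 0 <= exp kap by apply/Rlt_le/exp_pos.
pose L := ln (as_ / kap).
have L133 : 133 <= L.
  rewrite -(ln_exp 133); apply: ln_mono; first exact: exp_pos.
  by apply: (Rmult_le_reg_r kap) => //; rewrite /Rdiv Rmult_assoc Rinv_l; lra.
have as0 : 0 < as_ by have := Rmult_lt_0_compat _ _ (exp_pos 133) kap0; lra.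
rewrite -/L /TowR.
set H := / 30 * log2 (INR p) * L.
have lL : 2.9 * L <= l * L by apply: Rmult_le_compat_r; lra.
have lL0 : 0 < l * L by lra.
have HE : H * ln 2 = l * L / 30 by rewrite /H /log2 -/l; field; lra.
have H_lo : 0.138 * L <= H.
  apply: (Rmult_le_reg_r (ln 2)); first lra.
  have : L * ln 2 <= L * 0.7 by apply: Rmult_le_compat_l; lra.
  lra.
have H_up : H <= l * L / 15.
  apply: (Rmult_le_reg_r (ln 2)); first lra.
  have : l * L * / 2 <= l * L * ln 2 by apply: Rmult_le_compat_l; lra.
  lra.
(* As [L] is at least 133, [H] exceeds 18, so its floor is a successor; replacing [H] by [h] loses
   less than 2, which [0.018 * L] covers. *)
have [h hE hH] : exists2 h, Z.to_nat (Int_part H) = S h & INR h + 1 <= H < INR h + 2.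
  have [i1 i2] := base_Int_part H.
  have z0 : (0 <= Int_part H)%Z by apply/Z.lt_succ_r/lt_IZR; rewrite succ_IZR; lra.
  have hR : INR (Z.to_nat (Int_part H)) = IZR (Int_part H) by rewrite INR_IZR_INZ Znat.Z2Nat.id.
  case E : (Z.to_nat (Int_part H)) => [|h].
    by rewrite E /= in hR; lra.
  by exists h => //; rewrite E S_INR in hR; lra.
rewrite hE.
have [|j [j1 j2]] := @nat_ceil (1000 * kap); first lra.
have base := reachable_base p_pr p19 kap50 j1.
have j0 : 0 < INR j by lra.
have e12 : 0.9 * L <= ln (0.4 * as_ / (70 * INR j)) <= L.
  have as_E : as_ = kap * exp L by rewrite /L exp_ln; [field; lra | apply: Rdiv_lt_0_compat].
  split.
    rewrite -(ln_exp (0.9 * L)); apply: ln_mono; first exact: exp_pos.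
    apply: (Rmult_le_reg_r (70 * INR j)); first lra.
    rewrite /Rdiv Rmult_assoc Rinv_l ?Rmult_1_r; last lra.
    have -> : as_ = kap * (exp (0.9 * L) * exp (0.1 * L)) by rewrite -exp_plus as_E; do 2 f_equal; lra.
    (* With [j] up to [1.001 * 1000 * kap], the ratio needs [70 * 1001 / 0.4], about 175175. *)
    have big : 180000 <= exp (0.1 * L).
      apply: (Rle_trans _ (exp (INR 79 * (1 / 6)))); last by apply: exp_mono; rewrite INR_IZR_INZ /=; lra.
      rewrite exp_INR_mul; apply: (Rle_trans _ ((7 / 6) ^ 79)).
        by apply: ratio_pow_ge => //; rewrite -mult_IZR; apply/IZR_le/Z.leb_le; vm_compute.
      by apply: pow_incr; split; [lra | have := exp_ineq1_le (1 / 6); lra].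
    have E0 := exp_pos (0.9 * L).
    have ke : 0 < kap * exp (0.9 * L) by apply: Rmult_lt_0_compat.
    have := Rmult_le_compat_l _ _ _ (Rlt_le _ _ ke) big.
    have : exp (0.9 * L) * INR j <= exp (0.9 * L) * (1001 * kap) by apply: Rmult_le_compat_l; lra.
    lra.
  apply: ln_mono.
    by apply: Rdiv_lt_0_compat; lra.
  apply: (Rmult_le_reg_r (70 * INR j)); first lra.
  rewrite /Rdiv Rmult_assoc Rinv_l ?Rmult_1_r; last lra.
  have : as_ * / kap * (70 * (1000 * kap)) <= as_ * / kap * (70 * INR j).
    by apply: Rmult_le_compat_l; [apply/Rlt_le/Rdiv_lt_0_compat | lra].
  have -> : as_ * / kap * (70 * (1000 * kap)) = 70000 * as_ by field; lra.
  lra.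
have [||||g [g1 g9 gE]] := @growth_factor l (0.4 * as_) L (70 * INR j) h l29 L133 _ e12; try lra.
have [|n n_reach n_ge] := reachable_tower p_pr p19 kap50 kapll _ K0 g1 g9 base h; first lra.
rewrite gE in n_reach n_ge.
have [|n' [A [n'_ge A_ge A_le A_bdd]]] := reachable_final p_pr p19 kap50 _ (Tow_ge0 (INR p) h K0) n_reach n_ge.
  have : 133 ^ 3 / 27 <= exp 133 by apply: exp_ge_cube; lra.
  by move=> /(Rmult_le_compat_r kap _ _ (Rlt_le _ _ kap0)); lra.
by exists n', A; split; rewrite -?e_as.
Qed.

End Tower.

(** * Translation to [alpha] and [beta] *)

Theorem theorem8 (p : nat) (alpha beta : R) :
  prime p -> (19 <= p)%N ->
  (0 < alpha)%R -> (alpha <= / 2)%R ->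
  (Rpower alpha (3 + exp (-133)) <= beta)%R ->
  (beta <= alpha ^ 3 * Rmin (Rpower (INR p) (- log2 (INR p)))
                             (Rpower (INR p) (-50)))%R ->
  exists (n : nat) (A : {set 'rV['F_p]_n}),
    (TowR (INR p)
          (/ 30 * log2 (INR p) *
           ln (log2 (/ alpha) / log2 (alpha ^ 3 / beta)))
          (alpha ^ 3 / beta) <= INR n)%R /\
    (alpha <= density A)%R /\
    (forall d : 'rV['F_p]_n, d != GRing.zero -> (ap3_density A d < beta)%R).
Proof.
move=> p_pr p19 a0 a2 beta_ge beta_le.
have l29 := ln_p_ge p19.
set l := ln (INR p) in l29.
have ln2_lo := ln_lt_2; have ln2_up := ln2_le.
have beta0 : (0 < beta)%R by apply: Rlt_le_trans beta_ge; apply: exp_pos.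
have alpha3 : (0 < alpha ^ 3)%R by apply: pow_lt.
set K := (alpha ^ 3 / beta)%R.
have K0 : (0 < K)%R by apply: Rdiv_lt_0_compat.
pose kap := ln K.
have kapE : (kap = 3 * ln alpha - ln beta)%R.
  rewrite /kap /K /Rdiv ln_mult //; last exact: Rinv_0_lt_compat.
  by rewrite ln_Rinv // ln_pow_nat // (INR_IZR_INZ 3) /=; lra.
have kap_up : (exp 133 * kap <= - ln alpha)%R.
  have : (kap <= exp (-133) * - ln alpha)%R.
    have := ln_mono (exp_pos _) beta_ge; rewrite /Rpower ln_exp kapE; lra.
  move=> /(Rmult_le_compat_l (exp 133) _ _ (Rlt_le _ _ (exp_pos 133))).
  rewrite -Rmult_assoc -exp_plus; have -> : (133 + -133 = 0)%R by lra.
  by rewrite exp_0; lra.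
have ln_beta_le (x : R) : (beta <= alpha ^ 3 * exp x -> - x <= kap)%R.
  move=> /(ln_mono beta0); rewrite ln_mult //; last exact: exp_pos.
  by rewrite ln_exp ln_pow_nat // (INR_IZR_INZ 3) kapE /=; lra.
have kap50 : (50 * l <= kap)%R.
  suff : (- (-50 * l) <= kap)%R by lra.
  by apply: ln_beta_le; apply: Rle_trans beta_le _; apply: Rmult_le_compat_l; [lra | exact: Rmin_r].
(* The first term of the minimum gives [log2 p * l <= kap], and [log2 p >= l] because
   [ln 2 <= 1]. *)
have kapll : (l * l <= kap)%R.
  have : (- (- log2 (INR p) * l) <= kap)%R.
    by apply: ln_beta_le; apply: Rle_trans beta_le _; apply: Rmult_le_compat_l; [lra | exact: Rmin_l].
  have : (l * l <= log2 (INR p) * l)%R.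
    apply: Rmult_le_compat_r; first lra.
    rewrite /log2 -/l; apply: (Rmult_le_reg_r (ln 2)); first lra.
    have : (l * ln 2 <= l * 1)%R by apply: Rmult_le_compat_l; lra.
    by rewrite /Rdiv Rmult_assoc Rinv_l; lra.
  lra.
have ratioE : (log2 (/ alpha) / log2 K = - ln alpha / kap)%R.
  by rewrite /log2 ln_Rinv // -/kap; field; lra.
have [n [A [n_ge A_ge A_le A_bdd]]] := tower_construction p_pr p19 a0 kap50 kapll kap_up.
rewrite ratioE -{1}(exp_ln K) // -/kap.
exists n, A; split; [exact: n_ge | split; first exact: A_ge].
move=> d d0; apply: Rle_lt_trans (A_bdd d d0) _.
have ek : (exp (- kap) = beta / alpha ^ 3)%R.
  by rewrite exp_Ropp /kap exp_ln // /K; field; split; lra.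
have dA3 : (density A ^ 3 <= (1.1 * alpha) ^ 3)%R.
  by apply: pow_incr; split => //; apply: density_ge0.
apply: (Rle_lt_trans _ (exp (- kap) / 2 * (1.1 * alpha) ^ 3)%R).
  by apply: Rmult_le_compat_l => //; have := exp_pos (- kap); lra.
rewrite ek Rpow_mult_distr.
(* The strict inequality comes from [1.1 ^ 3 / 2 < 1]. *)
have -> : (beta / alpha ^ 3 / 2 * (1.1 ^ 3 * alpha ^ 3) = beta * (1.1 ^ 3 / 2))%R by field; lra.
lra.
Qed.
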